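(* For any countable set $T$ of formulas of $\mathcal{L}_\Diamond$ and any formula $\varphi\in\mathcal{L}_\Diamond$: $T\models_{GK}\varphi$ if and only if $T\vdash_{\mathcal{G}_\Diamond}\varphi$.
   Context: $\mathcal{L}_\Diamond$ is the set of formulas built from a set $Var$ of propositional variables using $\wedge,\to,\bot,\Diamond$, with $\neg\varphi:=\varphi\to\bot$, $\varphi\vee\psi:=((\varphi\to\psi)\to\psi)\wedge((\psi\to\varphi)\to\varphi)$, $\varphi\leftrightarrow\psi:=(\varphi\to\psi)\wedge(\psi\to\varphi)$. The Gödel calculus $\mathcal{G}$ has axiom schemes $(\varphi\to\psi)\to((\psi\to\chi)\to(\varphi\to\chi))$; $(\varphi\wedge\psi)\to\varphi$; $(\varphi\wedge\psi)\to(\psi\wedge\varphi)$; $(\varphi\to(\psi\to\chi))\leftrightarrow((\varphi\wedge\psi)\to\chi)$; $\varphi\to(\varphi\wedge\varphi)$; $((\varphi\to\psi)\to\chi)\to(((\psi\to\varphi)\to\chi)\to\chi)$; $\bot\to\varphi$; and Modus Ponens. $\mathcal{G}_\Diamond$ adds the schemes $\Diamond(\varphi\vee\psi)\to(\Diamond\varphi\vee\Diamond\psi)$, $\Diamond\neg\neg\varphi\to\neg\neg\Diamond\varphi$, $\neg\Diamond\bot$, and the rule ''from $\varphi\to\psi$ infer $\Diamond\varphi\to\Diamond\psi$''; $T\vdash_{\mathcal{G}_\Diamond}\varphi$ means derivability from assumptions $T$, with that rule applied only to theorems (steps not depending on assumptions). Semantics: on $[0,1]$, $a\cdot b=\min\{a,b\}$,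 $a\Rightarrow b=1$ if $a\le b$ and $=b$ otherwise. A GK-model $\langle W,S,e\rangle$ has a nonempty set $W$, arbitrary $S:W\times W\to[0,1]$ and $e:W\times Var\to[0,1]$, extended by $e(x,\varphi\wedge\psi)=e(x,\varphi)\cdot e(x,\psi)$, $e(x,\varphi\to\psi)=e(x,\varphi)\Rightarrow e(x,\psi)$, $e(x,\bot)=0$, $e(x,\Diamond\varphi)=\sup_{y\in W}\{Sxy\cdot e(y,\varphi)\}$. $T\models_{GK}\varphi$ means: for every GK-model and every world $x$, if $e(x,\psi)=1$ for all $\psi\in T$ then $e(x,\varphi)=1$. *)

(* Defs.v *)
(* Goedel modal logic of the possibility operator, over MathComp-Analysis. *)
From mathcomp Require Import all_boot all_order all_algebra.
From mathcomp Require Import boolp classical_sets functions cardinality reals.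

Set Implicit Arguments.
Unset Strict Implicit.
Unset Printing Implicit Defensive.

Import Order.TTheory GRing.Theory Num.Theory.

Local Open Scope classical_set_scope.
Local Open Scope ring_scope.

Inductive formula (Var : Type) : Type :=
| FVar of Var
| FBot
| FAnd of formula Var & formula Var
| FImp of formula Var & formula Var
| FDia of formula Var.

Arguments FBot {Var}.

Declare Scope formula_scope.
Delimit Scope formula_scope with F.
Bind Scope formula_scope with formula.

Notation "A `/\ B" := (FAnd A B)
  (at level 40, left associativity) : formula_scope.
Notation "A `-> B" := (FImp A B)
  (at level 55, right associativity) : formula_scope.
Notation "<> A" := (FDia A) (at level 35, right associativity) : formula_scope.

Definition FNeg (Var : Type) (A : formula Var) : formula Var := (A `-> FBot)%F.

Notation "`~ A" := (FNeg A) (at level 35, right associativity) : formula_scope.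

Definition FOr (Var : Type) (A B : formula Var) : formula Var :=
  (((A `-> B) `-> B) `/\ ((B `-> A) `-> A))%F.

Notation "A `\/ B" := (FOr A B)
  (at level 50, left associativity) : formula_scope.

Definition FIff (Var : Type) (A B : formula Var) : formula Var :=
  ((A `-> B) `/\ (B `-> A))%F.

Notation "A `<-> B" := (FIff A B) (at level 60) : formula_scope.

Inductive godel_axiom (Var : Type) : formula Var -> Prop :=
| G_trans A B C : godel_axiom ((A `-> B) `-> ((B `-> C) `-> (A `-> C)))
| G_andl A B : godel_axiom ((A `/\ B) `-> A)
| G_andC A B : godel_axiom ((A `/\ B) `-> (B `/\ A))
| G_curry A B C : godel_axiom ((A `-> (B `-> C)) `<-> ((A `/\ B) `-> C))
| G_contr A : godel_axiom (A `-> (A `/\ A))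
| G_prelin A B C :
    godel_axiom (((A `-> B) `-> C) `-> (((B `-> A) `-> C) `-> C))
| G_efq A : godel_axiom (FBot `-> A).

Inductive diamond_axiom (Var : Type) : formula Var -> Prop :=
| D_or A B : diamond_axiom (<> (A `\/ B) `-> (<> A `\/ <> B))
| D_negneg A : diamond_axiom (<> (`~ `~ A) `-> `~ `~ (<> A))
| D_bot : diamond_axiom (`~ (<> FBot)).

(* The monotonicity rule for the modality takes its premise from the empty set
   of assumptions, so it applies to theorems only. *)
Inductive gd_derivable (Var : Type) (T : set (formula Var)) :
    formula Var -> Prop :=
| der_assumption A : T A -> gd_derivable T A
| der_godel A : godel_axiom A -> gd_derivable T A
| der_diamond A : diamond_axiom A -> gd_derivable T A
| der_MP A B : gd_derivable T (A `-> B) -> gd_derivable T A -> gd_derivable T B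
| der_mono A B : gd_derivable set0 (A `-> B) -> gd_derivable T (<> A `-> <> B).

Definition gimp (R : realType) (a b : R) : R := if a <= b then 1 else b.

Record gk_model (R : realType) (Var : Type) := GKModel {
  world : Type;
  world_nonempty : inhabited world;
  acc : world -> world -> R;
  interp : world -> Var -> R;
  acc_unit : forall x y, 0 <= acc x y <= 1;
  interp_unit : forall x p, 0 <= interp x p <= 1
}.

(* [sup] is a genuine least upper bound here: the set of values is nonempty
   since there is a world, and it is included in the unit interval. *)
Fixpoint eval (R : realType) (Var : Type) (M : gk_model R Var)
    (x : world M) (A : formula Var) : R :=
  match A with
  | FVar p => interp x p
  | FBot => 0
  | FAnd B C => Num.min (eval x B) (eval x C)
  | FImp B C => gimp (eval x B) (eval x C)
  | FDia B => sup (range (fun y : world M => Num.min (acc x y) (eval y B)))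
  end.

Definition gk_consequence (R : realType) (Var : Type)
    (T : set (formula Var)) (A : formula Var) : Prop :=
  forall (M : gk_model R Var) (x : world M),
    (forall B, T B -> eval x B = 1) -> eval x A = 1.

(* Main.v *)
(* Suppose [phi] is not derivable from [T].  Worlds are pairs of a depth [n] and
   a theory [P] that is prime for the preorder [P (A `-> B)], and such a world
   takes its truth values from an embedding into [0, 1] of the linear order of
   [P]-equivalence classes of a countable set of formulas.  If [~ <> psi] is not
   in [P], a witness for [<> psi] must be a world of value 1 at [psi], where each
   [A] such that [<> A] lies strictly below [<> psi] in [P] has value at most
   that of [<> A].  The axioms give a prime theory [Q] containing [psi], refuting
   every [A] with [~ <> A] in [P] and omitting all those [A].  What remains is a
   metric condition, which is met by squeezing the intermediate values at depth
   [n + 1] below all the positive values at depth [n].  Suprema are therefore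
   attained, and no compactness argument is needed for infinite [T]. *)
Require Import Defs.
From mathcomp Require Import all_boot all_order all_algebra.
From mathcomp Require Import lra.
From mathcomp Require Import boolp classical_sets functions cardinality reals.

Set Implicit Arguments.
Unset Strict Implicit.
Unset Printing Implicit Defensive.

Import Order.TTheory GRing.Theory Num.Theory.

Local Open Scope classical_set_scope.
Local Open Scope ring_scope.

(** * Soundness *)

Section Soundness.
Variables (R : realType) (Var : Type).
Implicit Types (M : gk_model R Var) (A B : formula Var).

Lemma gimp_unit (a b : R) : 0 <= b <= 1 -> 0 <= gimp a b <= 1.
Proof. by rewrite /gimp; case: ifP => // _ _; rewrite lexx ler01. Qed.

Lemma gimp_eq1 (a b : R) : a <= b -> gimp a b = 1.
Proof. by rewrite /gimp => ->. Qed.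

(** Residuation: implication is right adjoint to [Num.min]. The bound on [c] serves the case
    [a <= b], where the implication is 1. *)
Lemma le_gimp (a b c : R) : c <= 1 -> (c <= gimp a b) = (Num.min c a <= b).
Proof.
by rewrite /gimp ge_min => c1; have [ab|ab] := leP a b; rewrite ?c1 ?orbT ?orbF.
Qed.

Lemma gimp1 (b : R) : b <= 1 -> gimp 1 b = b.
Proof. by rewrite /gimp => b1; case: leP => // ?; apply/eqP; rewrite eq_le b1 andbT. Qed.

Lemma gimp_min (a b c : R) : a <= 1 -> gimp a (gimp b c) = gimp (Num.min a b) c.
Proof.
move=> a1; have [bc|bc] := leP b c.
  by rewrite (gimp_eq1 bc) !gimp_eq1 // ge_min bc orbT.
by rewrite /gimp ge_min (lt_geF bc) orbF.
Qed.

Lemma min_unit (a b : R) :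
  0 <= a <= 1 -> 0 <= b <= 1 -> 0 <= Num.min a b <= 1.
Proof. by case: (leP a b). Qed.

Lemma sup_unit (X : set R) :
  X !=set0 -> (forall a, X a -> 0 <= a <= 1) -> 0 <= sup X <= 1.
Proof.
move=> [a Xa] XI; apply/andP; split.
  have /andP[a0 _] := XI a Xa; apply: (le_trans a0); apply: ub_le_sup => //.
  by exists 1 => b /XI /andP[].
by apply: ge_sup; [exists a | move=> b /XI /andP[]].
Qed.

Lemma eval_unit M (x : world M) A : 0 <= eval x A <= 1.
Proof.
elim: A x => [p||A IA B IB|A IA B IB|A IA] x /=.
- exact: interp_unit.
- by rewrite lexx ler01.
- exact: min_unit.
- exact: gimp_unit.
- apply: sup_unit; first by exists (Num.min (acc x x) (eval x A)), x.
  by move=> _ [y _ <-]; apply: min_unit => //; exact: acc_unit.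
Qed.

Lemma eval_imp_eq1 M (x : world M) A B :
  eval x A <= eval x B -> eval x (FImp A B) = 1.
Proof. exact: gimp_eq1. Qed.

Lemma eval_dia_ge M (x y : world M) A :
  Num.min (acc x y) (eval y A) <= eval x (FDia A).
Proof.
apply: ub_le_sup; last by exists y.
exists 1 => _ [z _ <-].
by have /andP[] := min_unit (acc_unit x z) (eval_unit z A).
Qed.

Lemma eval_dia_le M (x : world M) A (c : R) :
  (forall y, Num.min (acc x y) (eval y A) <= c) -> eval x (FDia A) <= c.
Proof.
move=> Hc; apply: ge_sup => [|_ [y _ <-]]; last exact: Hc.
by exists (Num.min (acc x x) (eval x A)), x.
Qed.

(** The conjunct that concludes in the larger of the two values evaluates to that value, and the
    other conjunct is no smaller. *)
Lemma eval_or M (x : world M) A B :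
  eval x (FOr A B) = Num.max (eval x A) (eval x B).
Proof.
have /andP[_ b1] := eval_unit x B; have /andP[_ a1] := eval_unit x A.
rewrite /=; have [AB|BA] := leP (eval x A) (eval x B).
  rewrite (gimp_eq1 AB) gimp1 // min_l //.
  have [BA|BA] := leP (eval x B) (eval x A); first by rewrite (gimp_eq1 BA) gimp1.
  by rewrite {2}/gimp (lt_geF BA) gimp_eq1.
rewrite (gimp_eq1 (ltW BA)) gimp1 // min_r // {2}/gimp (lt_geF BA).
by rewrite gimp_eq1.
Qed.

Lemma eval_godel_axiom M (x : world M) A : godel_axiom A -> eval x A = 1.
Proof.
have u1 B : eval x B <= 1 by have /andP[] := eval_unit x B.
have g1 a B : gimp a (eval x B) <= 1.
  by have /andP[] := gimp_unit a (eval_unit x B).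
case=> {A} [A B C|A B|A B|A B C|A|A B C|A] /=.
- apply: gimp_eq1; rewrite !le_gimp //; last by rewrite ge_min g1.
  set m := Num.min _ _; have [mAB mBC mA] :
      [/\ m <= gimp (eval x A) (eval x B), m <= gimp (eval x B) (eval x C)
        & m <= eval x A].
    by rewrite /m !ge_min !lexx !orbT.
  have m1 : m <= 1 := le_trans mA (u1 A).
  rewrite le_gimp // in mAB; rewrite le_gimp // in mBC.
  have mB : m <= eval x B by apply: le_trans mAB; rewrite le_min lexx.
  by apply: le_trans mBC; rewrite le_min lexx.
- by apply: gimp_eq1; rewrite ge_min lexx.
- by apply: gimp_eq1; rewrite minC.
- by rewrite (gimp_min (eval x B) (eval x C) (u1 A)) (gimp_eq1 (lexx _)) minxx.
- by apply: gimp_eq1; rewrite minxx.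
- apply: gimp_eq1; rewrite le_gimp //.
  have [AB|/ltW BA] := leP (eval x A) (eval x B).
    by rewrite (gimp_eq1 AB) gimp1 // ge_min lexx.
  by rewrite (gimp_eq1 BA) gimp1 // ge_min lexx orbT.
- by apply: gimp_eq1; have /andP[] := eval_unit x A.
Qed.

Lemma eval_diamond_axiom M (x : world M) A : diamond_axiom A -> eval x A = 1.
Proof.
case=> {A} [A B|A|].
- apply: eval_imp_eq1; rewrite eval_or; apply: eval_dia_le => y.
  rewrite eval_or le_max.
  have := eval_dia_ge x y A; have := eval_dia_ge x y B.
  case: (leP (eval y A) (eval y B)) => _ HB HA; first by rewrite HB orbT.
  by rewrite HA.
- apply: eval_imp_eq1; have /andP[d0 _] := eval_unit x (FDia A).
  (* A double negation only takes the values 0 and 1. In the case 0, [<> A] is 0 too, so each [y]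
     has accessibility 0 or value 0 at [A]. *)
  have [-> | dn0] := eqVneq (eval x (FNeg (FNeg (FDia A)))) 1.
    by have /andP[] := eval_unit x (FDia (FNeg (FNeg A))).
  have dia0 : eval x (FDia A) = 0.
    apply/eqP; rewrite eq_le d0 andbT leNgt; apply/negP => dgt.
    by move: dn0; rewrite /= /gimp; move: dgt => /= /lt_geF ->; rewrite lexx eqxx.
  have neg0 : eval x (FNeg (FNeg (FDia A))) = 0.
    by move: dia0 => /= ->; rewrite /gimp lexx ler10.
  rewrite neg0; apply: eval_dia_le => y.
  have := eval_dia_ge x y A; rewrite dia0 /=.
  have /andP[S0 _] := acc_unit x y; have /andP[a0 _] := eval_unit y A.
  rewrite /gimp; have [_|a_gt0] := leP (eval y A) 0.
    by move=> _; rewrite ler10 ge_min lexx orbT.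
  by rewrite ge_min (lt_geF a_gt0) orbF => S_le0; rewrite ge_min S_le0.
- apply: eval_imp_eq1; apply: eval_dia_le => y /=.
  by rewrite ge_min lexx orbT.
Qed.

Lemma soundness (T : set (formula Var)) A :
  gd_derivable T A -> gk_consequence R T A.
Proof.
elim=> {T A} [T A TA|T A GA|T A DA|T A B _ IAB _ IA|T A B _ IAB] M x HT.
- exact: HT.
- exact: eval_godel_axiom.
- exact: eval_diamond_axiom.
- have := IAB M x HT; have := IA M x HT => /= ->.
  have /andP[b0 b1] := eval_unit x B; rewrite /gimp; case: leP => // h _.
  by apply/eqP; rewrite eq_le b1 h.
- apply: eval_imp_eq1; apply: eval_dia_le => y; apply: le_trans (eval_dia_ge x y B).
  (* The premise of the rule has no assumptions, so it is valid at [y], where nothing is known about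
     [T]. *)
  rewrite le_min2 //; have /= := IAB M y (fun C => @False_ind _).
  have /andP[b0 b1] := eval_unit y B; have /andP[a0 a1] := eval_unit y A.
  by rewrite /gimp; case: leP => // /[swap] ->; rewrite ltNge a1.
Qed.

End Soundness.
(** * Prime theories *)

Section Calculus.
Variable Var : Type.
Implicit Types (A B C : formula Var) (T P : set (formula Var)).
Local Notation "T |- A" := (gd_derivable T A%F) (at level 70).

(** * Derived rules and the deduction theorem *)

Lemma der_sub T T' A : T `<=` T' -> T |- A -> T' |- A.
Proof.
move=> + dA; elim: dA T' => {T A}
  [T A TA|T A GA|T A DA|T A B _ IAB _ IA|T A B dAB _] T' sub.
- exact/der_assumption/sub.
- exact: der_godel.
- exact: der_diamond.
- exact: der_MP (IAB _ sub) (IA _ sub).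
- exact: der_mono.
Qed.

Lemma der_and_left T A B : T |- A `/\ B -> T |- A.
Proof. by apply: der_MP; apply: der_godel; exact: G_andl. Qed.

Lemma der_and_sym T A B : T |- A `/\ B -> T |- B `/\ A.
Proof. by apply: der_MP; apply: der_godel; exact: G_andC. Qed.

Lemma der_trans T A B C : T |- A `-> B -> T |- B `-> C -> T |- A `-> C.
Proof.
by move=> dAB; apply: der_MP; apply: der_MP dAB; apply: der_godel; exact: G_trans.
Qed.

Lemma der_uncurry T A B C : T |- A `-> B `-> C -> T |- (A `/\ B) `-> C.
Proof.
apply: der_MP; apply: der_and_left; apply: der_godel; exact: G_curry.
Qed.

Lemma der_curry T A B C : T |- (A `/\ B) `-> C -> T |- A `-> B `-> C.
Proof.
apply: der_MP; apply: der_and_left; apply: der_and_sym; apply: der_godel.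
exact: G_curry.
Qed.

Lemma der_id T A : T |- A `-> A.
Proof.
apply: (@der_trans _ _ (A `/\ A)%F); apply: der_godel; first exact: G_contr.
exact: G_andl.
Qed.

Lemma der_weak T A B : T |- B -> T |- A `-> B.
Proof. by apply: der_MP; apply: der_curry; apply: der_godel; exact: G_andl. Qed.

(** Contraction: [A] is duplicated, one copy is turned into [B], and the uncurried implication
    consumes both. *)
Lemma der_S T A B C : T |- A `-> B `-> C -> T |- A `-> B -> T |- A `-> C.
Proof.
move=> dABC dAB.
have dBA : T |- B `-> A `-> B `/\ A by apply: der_curry; exact: der_id.
apply: (@der_trans _ _ (A `/\ A)%F); first by apply: der_godel; exact: G_contr.
apply: (@der_trans _ _ (B `/\ A)%F); first exact: der_uncurry (der_trans dAB dBA).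
apply: (@der_trans _ _ (A `/\ B)%F); last exact: der_uncurry.
by apply: der_godel; exact: G_andC.
Qed.

(** The monotonicity rule does no harm: its conclusion is a theorem, so it can be weakened by
    [A]. *)
Lemma deduction T A B : A |` T |- B -> T |- A `-> B.
Proof.
move E: (A |` T) => T' dB; have {E} : T' `<=` A |` T by rewrite E.
elim: dB => {T' B} [T' B TB|T' B GB|T' B DB|T' B C _ IBC _ IB|T' B C dBC _] sub.
- have [->|TB'] := sub _ TB; first exact: der_id.
  exact/der_weak/der_assumption.
- exact/der_weak/der_godel.
- exact/der_weak/der_diamond.
- exact: der_S (IBC sub) (IB sub).
- exact/der_weak/der_mono.
Qed.

Lemma der_hyp T A : A |` T |- A.
Proof. by apply: der_assumption; left. Qed.

Lemma der_hypr T A B : T |- B -> A |` T |- B.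
Proof. exact/der_sub/subsetUr. Qed.

Lemma der_and T A B : T |- A -> T |- B -> T |- A `/\ B.
Proof.
move=> dA; apply: der_MP; apply: der_MP dA.
by apply: der_curry; exact: der_id.
Qed.

Lemma der_efq T A : T |- FBot -> T |- A.
Proof. by apply: der_MP; apply: der_godel; exact: G_efq. Qed.

Lemma der_prelin T A B C :
  (A `-> B)%F |` T |- C -> (B `-> A)%F |` T |- C -> T |- C.
Proof.
move=> /deduction dAB /deduction dBA; apply: der_MP dBA; apply: der_MP dAB.
by apply: der_godel; exact: G_prelin.
Qed.

Lemma der_orl T A B : T |- A -> T |- A `\/ B.
Proof.
move=> dA; apply: der_and; apply: deduction; last exact: der_hypr.
exact: der_MP (der_hyp _ _) (der_hypr _ dA).
Qed.

Lemma der_orr T A B : T |- B -> T |- A `\/ B.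
Proof.
move=> dB; apply: der_and; apply: deduction; first exact: der_hypr.
exact: der_MP (der_hyp _ _) (der_hypr _ dB).
Qed.

Lemma der_or_elim T A B C :
  T |- A `\/ B -> T |- A `-> C -> T |- B `-> C -> T |- C.
Proof.
move=> dO dA dB; apply: (@der_prelin _ A B).
  apply: der_MP (der_hypr _ dB) _.
  by apply: der_MP (der_hyp _ _); apply: der_hypr; exact: der_and_left dO.
apply: der_MP (der_hypr _ dA) _.
apply: der_MP (der_hyp _ _); apply: der_hypr.
by apply: der_and_left; exact: der_and_sym dO.
Qed.

(** Weak excluded middle is prelinearity for [A] and [~ A]: an implication from [A] to [~ A] yields
    [~ A], and the converse one yields [~ ~ A]. *)
Lemma der_wem T A C : T |- `~ A `-> C -> T |- `~ `~ A `-> C -> T |- C.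
Proof.
move=> dN dNN; apply: (@der_prelin _ A (`~ A)%F).
  apply: der_MP (der_hypr _ dN) _; apply: deduction.
  apply: der_MP (der_hyp _ _).
  exact: der_MP (der_hypr _ (der_hyp _ _)) (der_hyp _ _).
apply: der_MP (der_hypr _ dNN) _; apply: deduction.
apply: der_MP (der_hyp _ _) _.
exact: der_MP (der_hypr _ (der_hyp _ _)) (der_hyp _ _).
Qed.

(** * Prime theories and their construction by Zorn's lemma *)

Definition prime_theory P :=
  [/\ forall A, P |- A -> P A,
      forall A B, P (A `-> B)%F \/ P (B `-> A)%F
    & ~ P FBot].

(** A derivation uses finitely many assumptions, so one member of the chain contains them all; [T0]
    serves the steps that use none. *)
Lemma der_bigcup (F : set (set (formula Var))) T0 A :
  F T0 -> total_on F subset -> \bigcup_(T in F) T |- A ->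
  exists2 T, F T & T |- A.
Proof.
move=> FT0 Ftot.
move E: (\bigcup_(T in F) T) => U dA.
have {E} : U `<=` \bigcup_(T in F) T by rewrite E.
elim: dA => {U A} [U A UA|U A GA|U A DA|U A B _ IAB _ IA|U A B dAB _] sub.
- by have [T FT TA] := sub _ UA; exists T => //; exact: der_assumption.
- by exists T0 => //; exact: der_godel.
- by exists T0 => //; exact: der_diamond.
- have [T1 F1 d1] := IAB sub; have [T2 F2 d2] := IA sub.
  have [s|s] := Ftot _ _ F1 F2.
    by exists T2 => //; apply: der_MP d2; exact: der_sub d1.
  by exists T1 => //; apply: der_MP d1 _; exact: der_sub d2.
- by exists T0 => //; exact: der_mono.
Qed.

(** A whole family [Delta] has to stay out. Being directed, it behaves like a single formula in the
    maximality argument. *)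
Lemma prime_extension T (Delta : set (formula Var)) :
  Delta !=set0 ->
  (forall A B, Delta A -> Delta B ->
     exists C, [/\ Delta C, set0 |- A `-> C & set0 |- B `-> C]) ->
  (forall A, Delta A -> ~ T |- A) ->
  exists P, [/\ prime_theory P, T `<=` P & forall A, Delta A -> ~ P A].
Proof.
move=> [A0 DA0] Ddir TD.
(* The condition bears on the union with [T], so that it also holds of the empty set, the union of
   the empty chain. *)
pose good U := forall A, Delta A -> ~ (T `|` U) |- A.
have [F FG Ftot|U [gU maxU]] := @Zorn_bigcup (formula Var) good.
  have [-> A DA|/set0P[U0 FU0] A DA dA] := eqVneq F set0.
    by rewrite bigcup_set0 setU0; exact: TD.
  have [|||V [U FU <-] dA'] := @der_bigcup [set T `|` U | U in F] (T `|` U0) A.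
  - by exists U0.
  - move=> _ _ [U1 F1 <-] [U2 F2 <-].
    by have [s|s] := Ftot _ _ F1 F2; [left|right]; exact: setUS.
  - apply: der_sub dA => B [TB|[U FU UB]].
      by exists (T `|` U0); [exists U0 | left].
    by exists (T `|` U); [exists U | right].
  - exact: FG FU A DA dA'.
have ext B : ~ (T `|` U) |- B -> exists2 C, Delta C & B |` (T `|` U) |- C.
  move=> nB; apply: contrapT => noC; apply: (maxU (B |` U)).
    split; first by move=> C UC; right.
    by move=> s; apply: nB; apply: der_assumption; right; apply: s; left.
  move=> C DC dC; apply: noC; exists C => //.
  by apply: der_sub dC => E [TE|[->|UE]]; [right; left|left|right; right].
exists [set A | (T `|` U) |- A]; split => /=; last exact: gU.
- split=> [A|A B|dbot].
  + move E: {1}[set _ | _] => V dA.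
    have {E} : V `<=` [set A | (T `|` U) |- A] by rewrite -E.
    elim: dA => {V A} [V A VA|V A GA|V A DA|V A B _ IAB _ IA|V A B dAB _] sub.
    * exact: sub.
    * exact: der_godel.
    * exact: der_diamond.
    * exact: der_MP (IAB sub) (IA sub).
    * exact: der_mono.
  (* If neither implication were derivable, adding either would derive a member of [Delta];
     prelinearity then derives a common consequence [C] in [Delta]. *)
  + apply: contrapT => /not_orP[/ext[C1 D1 d1] /ext[C2 D2 d2]].
    have [C [DC d1C d2C]] := Ddir _ _ D1 D2.
    apply: (gU C DC); apply: (@der_prelin _ A B).
      by apply: der_MP d1; exact: der_sub d1C.
    by apply: der_MP d2; exact: der_sub d2C.
  + by apply: (gU A0 DA0); exact: der_efq.
- by move=> A TA; apply: der_assumption; left.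
Qed.

Section PrimeTheory.
Variables (P : set (formula Var)) (pP : prime_theory P).

Lemma prime_der A : P |- A -> P A.
Proof. by case: pP => h _ _; exact: h. Qed.

Lemma prime_linear A B : P (A `-> B)%F \/ P (B `-> A)%F.
Proof. by case: pP => _ h _; exact: h. Qed.

Lemma prime_consistent : ~ P FBot.
Proof. by case: pP. Qed.

Lemma prime_MP A B : P (A `-> B)%F -> P A -> P B.
Proof. by move=> /der_assumption dAB /der_assumption /(der_MP dAB) /prime_der. Qed.

(** Linearity compares [A] with the implication: one direction contracts to [A -> B] itself, and the
    other lets the implication supply its own antecedent. *)
Lemma prime_imp_equiv A B :
  ~ P (A `-> B)%F -> P ((A `-> B) `-> B)%F.
Proof.
move=> nAB; have [h|h] := prime_linear A (A `-> B)%F.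
  case: nAB; apply: prime_der; apply: der_S (der_id _ _).
  exact: der_assumption.
apply: prime_der; apply: der_S (der_id _ _) _.
exact: der_assumption.
Qed.

(** By [D_or], the disjunction lies below the larger of [<> A] and [<> B], which are comparable in
    [P]. *)
Lemma prime_dia_or A B C :
  P (C `-> <> (A `\/ B))%F -> P (C `-> <> A)%F \/ P (C `-> <> B)%F.
Proof.
move=> /der_assumption dC.
have {dC} dC : P |- C `-> <> A `\/ <> B.
  by apply: der_trans dC _; apply: der_diamond; exact: D_or.
have [/der_assumption AB|/der_assumption BA] := prime_linear (<> A) (<> B).
  right; apply: prime_der; apply: deduction.
  apply: (@der_or_elim _ (<> A) (<> B)); last exact: der_id.
    exact: der_MP (der_hypr _ dC) (der_hyp _ _).
  exact: der_hypr.
left; apply: prime_der; apply: deduction.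
apply: (@der_or_elim _ (<> A) (<> B)); [|exact: der_id|].
  exact: der_MP (der_hypr _ dC) (der_hyp _ _).
exact: der_hypr.
Qed.

Lemma prime_neg_dia_or A B :
  P (`~ <> A)%F -> P (`~ <> B)%F -> P (`~ <> (A `\/ B))%F.
Proof.
move=> nA nB; apply: prime_der; apply: deduction.
apply: (@der_or_elim _ (<> A) (<> B)).
- by apply: der_MP (der_hyp _ _); apply: der_diamond; exact: D_or.
- exact/der_hypr/der_assumption.
- exact/der_hypr/der_assumption.
Qed.

(* Finitely many assumptions [~ B] amount to one, as the formulas [B] with
   [~ <> B] in [P] are closed under disjunction. *)
Lemma der_neg_collect psi A :
  psi |` [set (`~ B)%F | B in [set B | P (`~ <> B)%F]] |- A ->
  exists2 B, P (`~ <> B)%F & set0 |- psi `-> `~ B `-> A.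
Proof.
move E: (psi |` _) => V dA.
have {E} : V `<=` psi |` [set (`~ B)%F | B in [set B | P (`~ <> B)%F]] by rewrite E.
(* By [D_bot], [FBot] can serve as [B] wherever no negated assumption is used. *)
have Pbot : P (`~ <> FBot)%F by apply: prime_der; apply: der_diamond; exact: D_bot.
elim: dA => {V A} [V A VA|V A GA|V A DA|V A A' _ IAB _ IA|V A A' dAB _] sub.
- have [->|[B PB <-]] := sub _ VA.
    exists FBot => //; apply: deduction; apply: der_weak; exact: der_hyp.
  by exists B => //; apply: der_weak; exact: der_id.
- by exists FBot => //; do 2 apply: der_weak; exact: der_godel.
- by exists FBot => //; do 2 apply: der_weak; exact: der_diamond.
- have [B1 P1 d1] := IAB sub; have [B2 P2 d2] := IA sub.
  exists (B1 `\/ B2)%F; first exact: prime_neg_dia_or.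
  do 2 apply: deduction.
  set U := _ |` _; have hpsi : U |- psi by exact/der_hypr/der_hyp.
  have hN : U |- `~ (B1 `\/ B2) by exact: der_hyp.
  have h1 : U |- `~ B1.
    by apply: deduction; apply: der_MP (der_hypr _ hN) _; apply: der_orl; exact: der_hyp.
  have h2 : U |- `~ B2.
    by apply: deduction; apply: der_MP (der_hypr _ hN) _; apply: der_orr; exact: der_hyp.
  apply: der_MP (der_MP (der_MP (der_sub (@sub0set _ _) d1) hpsi) h1) _.
  exact: der_MP (der_MP (der_sub (@sub0set _ _) d2) hpsi) h2.
- by exists FBot => //; do 2 apply: der_weak; exact: der_mono.
Qed.

(** The last property, read contrapositively, keeps out of [Q] every [A] with [<> A] strictly below
    [<> psi]; by [prime_dia_or] these [A] are directed under disjunction. *)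
Lemma prime_witness psi :
  ~ P (`~ <> psi)%F ->
  exists Q, [/\ prime_theory Q, Q psi,
    forall A, P (`~ <> A)%F -> Q (`~ A)%F &
    forall A, Q A -> P (<> psi `-> <> A)%F].
Proof.
move=> npsi.
have [|A B nA nB|A nA /der_neg_collect[B PB d]|Q [pQ sub nQ]] := @prime_extension
  (psi |` [set (`~ B)%F | B in [set B | P (`~ <> B)%F]])
  [set A | ~ P (<> psi `-> <> A)%F].
- exists FBot => /= /der_assumption h; apply: npsi; apply: prime_der.
  by apply: der_trans h _; apply: der_diamond; exact: D_bot.
- exists (A `\/ B)%F; split; first by move=> /prime_dia_or[].
    by apply: deduction; apply: der_orl; exact: der_hyp.
  by apply: deduction; apply: der_orr; exact: der_hyp.
- apply: nA.
  (* Weak excluded middle for [B] trades the hypothesis [~ B] for a disjunct, which leaves a theorem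
     to which the monotonicity rule and [D_or] apply. *)
  have {}d : set0 |- psi `-> A `\/ `~ `~ B.
    apply: deduction; apply: (@der_wem _ B); apply: deduction.
      apply: der_orl; apply: der_MP (der_hyp _ _).
      exact: der_MP (der_sub (@sub0set _ _) d) (der_hypr _ (der_hyp _ _)).
    by apply: der_orr; exact: der_hyp.
  have [//|h] : P (<> psi `-> <> A)%F \/ P (<> psi `-> <> (`~ `~ B))%F.
    by apply: prime_dia_or; apply: prime_der; exact: der_mono.
  (* In this case [D_negneg] takes [<> psi] to [~ ~ <> B], against [~ <> B] in [P], so [P] would
     contain [~ <> psi]. *)
  case: npsi; apply: prime_der; apply: deduction.
  apply: der_MP (der_hypr _ (der_assumption PB)).
  apply: der_MP (der_diamond _ (D_negneg B)) _.
  exact: der_MP (der_hypr _ (der_assumption h)) (der_hyp _ _).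
- exists Q; split=> //.
  + by apply: sub; left.
  + by move=> A PA; apply: sub; right; exists A.
  + by move=> A QA; apply: contrapT => /nQ.
Qed.

End PrimeTheory.
End Calculus.

(** * Embedding countable linear orders *)

Section SubsetWeight.
Variable R : realType.
Implicit Types (X Y : set nat) (n : nat).

Let partial_weight X n : R := \sum_(k < n) (if `[< X k >] then 2^-1 ^+ k.+1 else 0).

(** The real number whose binary digits are the characteristic function of [X]. Such expansions are
    not unique, but strictly nested sets still get distinct values. *)
Definition weight X : R := sup (range (partial_weight X)).

Let half_exp_ge0 n : 0 <= 2^-1 ^+ n :> R.
Proof. by rewrite exprn_ge0 // invr_ge0 ler0n. Qed.

Let partial_weight_le1 X n : partial_weight X n <= 1.
Proof.
(* The sharper bound is the one that passes through the induction. *)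
suff : partial_weight X n <= 1 - 2^-1 ^+ n.
  by move=> /le_trans; apply; rewrite gerBl half_exp_ge0.
rewrite /partial_weight; elim: n => [|n IH].
  by rewrite big_ord0 expr0 subrr.
rewrite big_ord_recr /=.
have : (if `[< X n >] then 2^-1 ^+ n.+1 else 0) <= 2^-1 ^+ n.+1 :> R.
  by case: ifP; rewrite ?lexx // half_exp_ge0.
move: IH; rewrite [2^-1 ^+ n.+1]exprS; set t := _ ^+ n; set u := if _ then _ else _.
set v := \sum_(_ < _) _; move=> IH h; lra.
Qed.

Let partial_weight_ub X : has_ubound (range (partial_weight X)).
Proof. by exists 1 => _ [n _ <-]; exact: partial_weight_le1. Qed.

Lemma weight_unit X : 0 <= weight X <= 1.
Proof.
apply/andP; split.
  by apply: ub_le_sup => //; exists 0 => //; rewrite /partial_weight big_ord0.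
apply: ge_sup => [|_ [n _ <-]]; last exact: partial_weight_le1.
by exists (partial_weight X 0), 0.
Qed.

Lemma weight_le X Y : X `<=` Y -> weight X <= weight Y.
Proof.
move=> XY; apply: ge_sup => [|_ [n _ <-]]; first by exists (partial_weight X 0), 0.
apply: (@le_trans _ _ (partial_weight Y n)); last by apply: ub_le_sup => //; exists n.
apply: ler_sum => k _; case: asboolP => [/XY Yk|_].
  by case: asboolP.
by case: ifP => // _; rewrite half_exp_ge0.
Qed.

(** A strict inequality of partial sums may be lost in the supremum; the fixed gap [e], the weight
    of digit [m], survives it. *)
Lemma weight_lt X Y m : X `<=` Y -> ~ X m -> Y m -> weight X < weight Y.
Proof.
move=> XY nXm Ym; pose e : R := 2^-1 ^+ m.+1.
have e0 : 0 < e by rewrite exprn_gt0 // invr_gt0 ltr0n.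
suff : weight X + e <= weight Y by apply: lt_le_trans; rewrite ltrDl.
rewrite -lerBrDr; apply: ge_sup => [|_ [n _ <-]].
  by exists (partial_weight X 0), 0.
(* The sum is extended far enough to include digit [m]. *)
rewrite lerBrDr; pose N := maxn n m.+1.
apply: (@le_trans _ _ (partial_weight Y N)); last by apply: ub_le_sup => //; exists N.
have mN : (m < N)%N by rewrite leq_max leqnn orbT.
apply: (@le_trans _ _ (partial_weight X N + e)).
  rewrite lerD2r /partial_weight.
  rewrite -(big_mkord xpredT (fun k => if `[< X k >] then 2^-1 ^+ k.+1 else 0)).
  rewrite -(big_mkord xpredT (fun k => if `[< X k >] then 2^-1 ^+ k.+1 else 0)).
  rewrite [leRHS](big_cat_nat (n := n)) //= ?leq_maxl // lerDl.
  by apply: sumr_ge0 => k _; case: ifP; rewrite ?lexx // half_exp_ge0.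
rewrite /partial_weight (bigD1 (Ordinal mN)) //= [leRHS](bigD1 (Ordinal mN)) //=.
case: asboolP => // _; case: asboolP => // _; rewrite -/e add0r addrC lerD2r.
apply: ler_sum => k _; case: asboolP => [/XY Yk|_].
  by case: asboolP.
by case: ifP => // _; rewrite half_exp_ge0.
Qed.

End SubsetWeight.

(** * The canonical model *)

Section CanonicalModel.
Variables (R : realType) (Var : Type).
Variables (D : set (formula Var)) (code : formula Var -> nat).
Hypothesis code_inj : forall A B, D A -> D B -> code A = code B -> A = B.
Implicit Types (A B : formula Var) (P Q : set (formula Var)) (d : nat).

(** These initial segments of [D] are nested because [P] is linear, so [weight] turns the preorder
    into an order of reals. *)
Definition lower_codes P A : set nat :=
  [set code B | B in [set B | D B /\ P (B `-> A)%F]].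

(** As [1 + weight] can reach 2, the exponent [d.+2] keeps intermediate values below 1 even at depth
    0; the summand 1 keeps them positive. *)
Definition theory_val d P A : R :=
  if `[< P A >] then 1 else if `[< P (`~ A)%F >] then 0
  else 2^-1 ^+ d.+2 * (1 + weight R (lower_codes P A)).

Lemma lower_codes_sub P A B :
  prime_theory P -> P (A `-> B)%F -> lower_codes P A `<=` lower_codes P B.
Proof.
move=> pP PAB _ [C [DC PCA] <-]; exists C => //; split => //.
by apply: (prime_der pP); exact: der_trans (der_assumption PCA) (der_assumption PAB).
Qed.

Lemma theory_val1 d P A : P A -> theory_val d P A = 1.
Proof. by rewrite /theory_val; case: asboolP. Qed.

Lemma theory_val0 d P A :
  prime_theory P -> P (`~ A)%F -> theory_val d P A = 0.
Proof.
move=> pP PN; rewrite /theory_val; case: asboolP => [PA|_].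
  by case: (prime_consistent pP); exact: prime_MP PN PA.
by case: asboolP.
Qed.

Lemma theory_val_gt d P A :
  ~ P (`~ A)%F -> 2^-1 ^+ d.+2 <= theory_val d P A.
Proof.
move=> nN; rewrite /theory_val; case: asboolP => _.
  by rewrite exprn_ile1 // ?invr_ge0 ?ler0n // invf_le1 ?ler1n // ltr0n.
case: asboolP => // _; have /andP[w0 _] := weight_unit R (lower_codes P A).
by rewrite ler_peMr ?exprn_ge0 ?invr_ge0 ?ler0n // lerDl.
Qed.

(** At depth [d.+1] this bound is exactly the lower bound of [theory_val_gt] at depth [d]. *)
Lemma theory_val_le d P A : ~ P A -> theory_val d P A <= 2^-1 ^+ d.+1.
Proof.
move=> nA; rewrite /theory_val; case: asboolP => // _.
case: asboolP => _; first by rewrite exprn_ge0 // invr_ge0 ler0n.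
have /andP[_ w1] := weight_unit R (lower_codes P A).
have -> : 2^-1 ^+ d.+1 = 2^-1 ^+ d.+2 * 2 :> R.
  by rewrite [2^-1 ^+ d.+2]exprSr -mulrA mulVf ?mulr1 // pnatr_eq0.
by rewrite ler_pM2l ?exprn_gt0 ?invr_gt0 ?ltr0n //; lra.
Qed.

Lemma theory_val_lt1 d P A : ~ P A -> theory_val d P A < 1.
Proof.
move=> /(@theory_val_le d) /le_lt_trans; apply.
by rewrite exprn_ilt1 // ?invr_ge0 ?ler0n // invf_lt1 ?ltr1n // ltr0n.
Qed.

Lemma theory_val_unit d P A : 0 <= theory_val d P A <= 1.
Proof.
apply/andP; split; last first.
  have [PA|/(@theory_val_lt1 d)/ltW//] := pselect (P A).
  by rewrite theory_val1.
have [PN|/(@theory_val_gt d)] := pselect (P (`~ A)%F); last first.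
  by apply: le_trans; rewrite exprn_ge0 // invr_ge0 ler0n.
by rewrite /theory_val; do 2 case: asboolP => // _.
Qed.

(** * Truth values and the propositional connectives *)

Section Theory.
Variables (P : set (formula Var)) (d : nat).
Hypothesis pP : prime_theory P.

Lemma theory_val_mono A B :
  P (A `-> B)%F -> theory_val d P A <= theory_val d P B.
Proof.
move=> PAB; have [PA|nA] := pselect (P A).
  by rewrite !theory_val1 //; exact: prime_MP PAB PA.
have [NA|nNA] := pselect (P (`~ A)%F).
  by rewrite (theory_val0 d pP NA); have /andP[] := theory_val_unit d P B.
have [PB|nB] := pselect (P B).
  by rewrite (theory_val1 d PB); have /andP[] := theory_val_unit d P A.
have nNB : ~ P (`~ B)%F.
  move=> NB; apply: nNA; apply: (prime_der pP).
  exact: der_trans (der_assumption PAB) (der_assumption NB).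
rewrite /theory_val; do 4 case: asboolP => // _.
rewrite ler_pM2l ?exprn_gt0 ?invr_gt0 ?ltr0n // lerD2l.
exact/weight_le/lower_codes_sub.
Qed.

(** The code of [A] separates the two initial segments: by injectivity on [D], finding it below [B]
    would put [A -> B] in [P]. *)
Lemma theory_val_lt A B :
  D A -> ~ P (A `-> B)%F -> theory_val d P B < theory_val d P A.
Proof.
move=> DA nAB; have PBA : P (B `-> A)%F by case: (prime_linear pP A B).
have nB : ~ P B.
  by move=> PB; apply: nAB; apply: (prime_der pP); exact/der_weak/der_assumption.
have [PA|nA] := pselect (P A); first by rewrite (theory_val1 d PA) theory_val_lt1.
have nNA : ~ P (`~ A)%F.
  move=> NA; apply: nAB; apply: (prime_der pP).
  apply: der_trans (der_assumption NA) _; apply: der_godel; exact: G_efq.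
have [NB|nNB] := pselect (P (`~ B)%F).
  rewrite (theory_val0 d pP NB); apply: lt_le_trans (theory_val_gt d nNA).
  by rewrite exprn_gt0 // invr_gt0 ltr0n.
rewrite /theory_val; do 4 case: asboolP => // _.
rewrite ltr_pM2l ?exprn_gt0 ?invr_gt0 ?ltr0n // ltrD2l.
apply: (@weight_lt _ _ _ (code A)); first exact: lower_codes_sub.
  by move=> [C [DC PCB] /(code_inj DC DA) CA]; apply: nAB; rewrite -CA.
by exists A => //; split=> //; apply: (prime_der pP); exact: der_id.
Qed.

Lemma theory_val_eq A B :
  P (A `-> B)%F -> P (B `-> A)%F -> theory_val d P A = theory_val d P B.
Proof. by move=> AB BA; apply/le_anti; rewrite !theory_val_mono. Qed.

Lemma theory_val_and A B :
  theory_val d P (A `/\ B)%F = Num.min (theory_val d P A) (theory_val d P B).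
Proof.
have dl : P ((A `/\ B) `-> A)%F by apply: (prime_der pP); apply: der_godel; exact: G_andl.
have dr : P ((A `/\ B) `-> B)%F.
  apply: (prime_der pP); apply: deduction; apply: (@der_and_left _ _ _ A).
  by apply: der_and_sym; exact: der_hyp.
have [AB|BA] := prime_linear pP A B.
  rewrite min_l ?theory_val_mono //; apply: theory_val_eq => //.
  apply: (prime_der pP); apply: deduction; apply: der_and; first exact: der_hyp.
  exact: der_MP (der_hypr _ (der_assumption AB)) (der_hyp _ _).
rewrite min_r ?theory_val_mono //; apply: theory_val_eq => //.
apply: (prime_der pP); apply: deduction; apply: der_and; last exact: der_hyp.
exact: der_MP (der_hypr _ (der_assumption BA)) (der_hyp _ _).
Qed.

Lemma theory_val_imp A B : D A ->
  theory_val d P (A `-> B)%F = gimp (theory_val d P A) (theory_val d P B).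
Proof.
move=> DA; have [AB|nAB] := pselect (P (A `-> B)%F).
  by rewrite theory_val1 // gimp_eq1 // theory_val_mono.
rewrite /gimp (lt_geF (theory_val_lt DA nAB)); apply: theory_val_eq.
  exact: prime_imp_equiv.
by apply: (prime_der pP); apply: deduction; apply: der_weak; exact: der_hyp.
Qed.

End Theory.

(* A world is a prime theory with a depth [n]; its truth values strictly
   between 0 and 1 lie in [[2^-(n+2), 2^-(n+1)]], below all the positive values
   of the worlds of smaller depth. *)
Definition canonical_world : Type :=
  (nat * {P : set (formula Var) | prime_theory P})%type.

Definition world_val (x : canonical_world) A : R := theory_val x.1 (sval x.2) A.

(** By residuation, the greatest accessibility for which no value at [y] pushes a diamond above its
    intended value at [x]. *)
Definition canonical_acc (x y : canonical_world) : R :=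
  inf (range (fun A => gimp (world_val y A) (world_val x (<> A)%F))).

Lemma world_gimp_unit (x y : canonical_world) A :
  0 <= gimp (world_val y A) (world_val x (<> A)%F) <= 1.
Proof. by apply: gimp_unit; exact: theory_val_unit. Qed.

Lemma canonical_acc_le x y A :
  canonical_acc x y <= gimp (world_val y A) (world_val x (<> A)%F).
Proof.
apply: ge_inf; last by exists A.
by exists 0 => _ [B _ <-]; have /andP[] := world_gimp_unit x y B.
Qed.

Lemma canonical_acc_ge x y (c : R) :
  (forall A, c <= gimp (world_val y A) (world_val x (<> A)%F)) ->
  c <= canonical_acc x y.
Proof.
move=> Hc; apply: lb_le_inf => [|_ [A _ <-]]; last exact: Hc.
by exists (gimp (world_val y FBot) (world_val x (<> FBot)%F)), FBot.
Qed.

Lemma canonical_acc_unit x y : 0 <= canonical_acc x y <= 1.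
Proof.
apply/andP; split.
  by apply: canonical_acc_ge => A; have /andP[] := world_gimp_unit x y A.
apply: le_trans (canonical_acc_le x y FBot) _.
by have /andP[] := world_gimp_unit x y FBot.
Qed.

Definition canonical_model (x : canonical_world) : gk_model R Var :=
  @GKModel R Var canonical_world (inhabits x) canonical_acc
    (fun y p => world_val y (FVar p)) canonical_acc_unit
    (fun y p => theory_val_unit y.1 (sval y.2) (FVar p)).

(** This is where the squeezing of values by depth pays off: the supremum is attained at a single
    world. *)
Lemma canonical_witness x A : exists y,
  world_val x (<> A)%F <= Num.min (canonical_acc x y) (world_val y A).
Proof.
case: x => d [P pP]; set x := (d, _).
have [NA|nNA] := pselect (P (`~ <> A)%F).
  (* The diamond has value 0, so any world will do. *)
  exists x; rewrite [leLHS](theory_val0 d pP NA) le_min.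
  have /andP[-> _] := canonical_acc_unit x x.
  by have /andP[] := theory_val_unit d P A.
have [Q [pQ QA QN Qdia]] := prime_witness pP nNA.
exists (d.+1, exist _ Q pQ); rewrite le_min; apply/andP; split; last first.
  rewrite [leRHS]theory_val1 //.
  by have /andP[] := theory_val_unit d P (<> A)%F.
apply: canonical_acc_ge => B; rewrite /world_val /=.
have /andP[_ vA1] := theory_val_unit d P (<> A)%F.
have /andP[_ vB1] := theory_val_unit d P (<> B)%F.
(* If [<> B] is above [<> A], the implication is at least the value of [<> B]. Otherwise it has to
   be 1, that is, [B] at the new world must not exceed [<> B] at [x]. *)
have [AB|nAB] := pselect (P (<> A `-> <> B)%F).
  apply: le_trans (theory_val_mono d pP AB) _.
  by rewrite le_gimp // ge_min lexx.
rewrite gimp_eq1 //; have [NB|nNB] := pselect (P (`~ <> B)%F).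
  rewrite (theory_val0 _ pQ (QN _ NB)).
  by have /andP[] := theory_val_unit d P (<> B)%F.
(* [B] is outside [Q], so at depth [d.+1] its value is at most the lower bound for positive values
   at depth [d]. *)
apply: le_trans (theory_val_gt d nNB); apply: theory_val_le => QB.
exact/nAB/Qdia.
Qed.

Hypotheses (D_and : forall A B, D (A `/\ B)%F -> D A /\ D B)
  (D_imp : forall A B, D (A `-> B)%F -> D A /\ D B)
  (D_dia : forall A, D (<> A)%F -> D A).

(** Truth lemma. For the diamond, one inequality is built into [canonical_acc] by residuation, and
    the other comes from the witness. *)
Lemma canonical_eval (w x : canonical_world) A :
  D A -> @eval R Var (canonical_model w) x A = world_val x A.
Proof.
elim: A x => [p||A IA B IB|A IA B IB|A IA] x DA.
- by [].
- case: x => d [P pP]; rewrite /world_val theory_val0 //=.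
  by apply: (prime_der pP); exact: der_id.
- have [dA dB] := D_and DA; rewrite /= IA // IB // /world_val theory_val_and //.
  exact: svalP.
- have [dA dB] := D_imp DA; rewrite /= IA // IB // /world_val theory_val_imp //.
  exact: svalP.
- have dA := D_dia DA; apply/le_anti/andP; split.
    apply: eval_dia_le => y; rewrite IA // -le_gimp; last first.
      by have /andP[] := canonical_acc_unit x y.
    exact: canonical_acc_le.
  have [y /le_trans] := canonical_witness x A; apply.
  by rewrite -(IA y dA); exact: (@eval_dia_ge _ _ (canonical_model w)).
Qed.

End CanonicalModel.

(** * Countability and the subformula closure *)

Lemma countable_setU (X : Type) (A B : set X) :
  countable A -> countable B -> countable (A `|` B).
Proof.
move=> cA cB; have -> : A `|` B = \bigcup_(b in [set: bool]) (if b then A else B).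
  apply/seteqP; split=> [a [Aa|Ba]|a [[] _ ?]]; [|by exists false|by left|by right].
  by exists true.
by apply: bigcup_countable => [|[] _ //]; exact: countableP.
Qed.

Section Subformulas.
Variable Var : Type.
Implicit Types (A B : formula Var).

Fixpoint subformulas A : set (formula Var) :=
  A |` match A with
  | FVar _ | FBot => set0
  | FAnd B C | FImp B C => subformulas B `|` subformulas C
  | FDia B => subformulas B
  end.

Lemma subformulas_refl A : subformulas A A.
Proof. by case: A => *; left. Qed.

Lemma subformulas_trans A B C :
  subformulas A B -> subformulas B C -> subformulas A C.
Proof.
elim: A => [p||A1 I1 A2 I2|A1 I1 A2 I2|A1 I1] /= [->//|].
- by [].
- by [].
- by move=> [/I1 h|/I2 h] /h; right; [left|right].
- by move=> [/I1 h|/I2 h] /h; right; [left|right].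
- by move=> /I1 h /h; right.
Qed.

Lemma finite_subformulas A : finite_set (subformulas A).
Proof.
by elim: A => [p||A1 I1 A2 I2|A1 I1 A2 I2|A1 I1] /=; rewrite ?setU0 ?finite_setU //;
  split => //; exact: finite_set1.
Qed.

End Subformulas.

(** * Completeness for countable sets of assumptions *)

Theorem theorem17 (R : realType) (Var : Type) (T : set (formula Var))
  (phi : formula Var) (hT : countable T) :
  gk_consequence R T phi <-> gd_derivable T phi.
Proof.
split; last exact: soundness.
move=> hphi; apply: contrapT => nphi.
have [|A B -> ->|A ->|P [pP TP nP]] := @prime_extension Var T [set phi].
- by exists phi.
- by exists phi; split=> //; exact: der_id.
- exact: nphi.
(* The truth lemma is applied to [phi] and to every member of [T], so [D] closes them all under
   subformulas; countability of [T] is what makes [D] codable by naturals. *)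
pose D := \bigcup_(A in phi |` T) subformulas A.
have Dsub A B : D A -> subformulas A B -> D B.
  by move=> [C TC CA] AB; exists C => //; exact: subformulas_trans CA AB.
have [code code_inj] : exists code : formula Var -> nat,
    forall A B, D A -> D B -> code A = code B -> A = B.
  have /countable_injP[f finj] : countable D.
    apply: bigcup_countable => [|A _]; first exact: countable_setU (countable1 _) hT.
    exact/finite_set_countable/finite_subformulas.
  by exists f => A B DA DB; apply: finj; rewrite inE.
have DT A : (phi |` T) A -> D A by exists A => //; exact: subformulas_refl.
pose x : canonical_world Var := (0%N, exist _ P pP).
have ev A : D A -> @eval R Var (canonical_model R D code x) x A = world_val R D code x A.
  move: A; apply: (canonical_eval R code_inj).
  - by move=> B C DBC; split; apply: Dsub DBC _; right; [left|right]; exact: subformulas_refl.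
  - by move=> B C DBC; split; apply: Dsub DBC _; right; [left|right]; exact: subformulas_refl.
  - by move=> B DB; apply: Dsub DB _; right; exact: subformulas_refl.
have := hphi (canonical_model R D code x) x; rewrite ev; last by apply: DT; left.
have /lt_eqF/eqP nv := @theory_val_lt1 R _ D code 0 P phi (nP phi erefl).
move=> /(_ _)/nv; apply=> A TA; rewrite ev; last by apply: DT; right.
by apply: theory_val1; exact: TP.
Qed.
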